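(* Let $p$ be an odd prime and let $x$, $q$ be indeterminates. Then $$\sum_{k=0}^{p-1}\frac{(q;q^2)_k^2}{(q^2;q^2)_k^2}x^k \equiv \left(\frac{-1}{p}\right) q^{\frac{1-p^2}{4}} \sum_{k=0}^{p-1}\frac{(q;q^2)_k^2}{(q^2;q^2)_k^2} q^{2k}(x;q^2)_k \pmod{[p]^2}.$$
   Context: $q$ is an indeterminate. $(a;q)_0=1$ and $(a;q)_n=(1-a)(1-aq)\cdots(1-aq^{n-1})$ for $n\ge 1$; so $(a;q^m)_n=\prod_{j=0}^{n-1}(1-aq^{mj})$. $\left(\frac{\cdot}{p}\right)$ is the Legendre symbol modulo $p$. $[p]=1+q+\cdots+q^{p-1}$, which is irreducible in $\mathbb{Q}[q]$ for $p$ prime. For rational functions $A(q),B(q)\in\mathbb{Q}(q)$ whose denominators are relatively prime to $[p]$, $A\equiv B\pmod{[p]^r}$ means that $A-B$ can be written as a fraction whose numerator is divisible by $[p]^r$ in $\mathbb{Q}[q]$ and whose denominator is relatively prime to $[p]$ (negative powers of $q$ are allowed). For polynomials in $x$ with such coefficients, congruence modulo $[p]^r$ means congruence of the coefficients of $x^k$ modulo $[p]^r$ for every $k$. *)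

(* Defs.v *)
From HB Require Import structures.
From mathcomp Require Import all_boot all_order all_algebra.
Set Implicit Arguments.
Unset Strict Implicit.
Unset Printing Implicit Defensive.
Import Order.TTheory GRing.Theory Num.Theory.
Local Open Scope ring_scope.

Notation Qq := {fraction {poly rat}}.

Definition qvar : Qq := tofrac ('X : {poly rat}).

(* (a; b)_n, with the base b explicit, in any commutative ring, so that it can
   be used both in Qq and in {poly Qq}. *)
Definition qpoch (R : comNzRingType) (a b : R) (n : nat) : R :=
  \prod_(j < n) (1 - a * b ^+ j).

Definition qint (n : nat) : {poly rat} := \sum_(i < n) 'X^i.

(* Only meaningful for p prime. *)
Definition legendre (a : int) (p : nat) : int :=
  if (p%:Z %| a)%Z then 0
  else if [exists y : 'F_p, y ^+ 2 == a%:~R] then 1 else -1.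

Definition denom_coprime (M : {poly rat}) (A : Qq) : Prop :=
  exists N D : {poly rat}, coprimep D M /\ A = tofrac N / tofrac D.

(* A = B mod M^r, as a relation on the rational functions whose denominators
   are relatively prime to M: this condition on A and B is part of the
   relation. In all uses M is not constant, so that coprimep D M forces
   D != 0. *)
Definition qcong (M : {poly rat}) (r : nat) (A B : Qq) : Prop :=
  [/\ denom_coprime M A, denom_coprime M B &
      exists N D : {poly rat},
        [/\ M ^+ r %| N, coprimep D M & A - B = tofrac N / tofrac D]].

Definition qcong_poly (M : {poly rat}) (r : nat) (P Q : {poly Qq}) : Prop :=
  forall k : nat, qcong M r P`_k Q`_k.

(* Main.v *)
Require Import Defs.
From mathcomp Require Import all_boot all_order all_algebra.
From mathcomp Require Import finfield ring.
Import Order.TTheory GRing.Theory Num.Theory.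
Local Open Scope ring_scope.

Set Implicit Arguments.
Unset Strict Implicit.
Unset Printing Implicit Defensive.

(** Write p = 2n + 1, Q = q^2 and
    [a_k = (Q^(-n); Q)_k (Q^(n+1); Q)_k / (Q; Q)_k^2].  Since Q^(-n) = q^(1-p)
    and Q^(n+1) = q^(1+p), the identity
    [(1 - q^(2j+1))^2 - (1 - q^(2j+1-p)) (1 - q^(2j+1+p))
       = q^(2j+1-p) (1 - q^p)^2]
    shows that replacing [(q; q^2)_k^2 / (q^2; q^2)_k^2] by a_k changes both
    sides only by multiples of [p]^2: [p] divides 1 - q^p, and the
    denominators (q^2; q^2)_k with k < p are coprime to [p] (lemmas
    [qpoch_sqr_cong], [coprimep_1subXn_qint]).

    After the replacement the two sides are equal, because of the exact identity
    [sum_k a_k x^k = (-1)^n Q^(-n(n+1)/2) sum_k a_k Q^k (x; Q)_k]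
    (lemma [qleg_reflection]), a q-analogue of the symmetry
    P_n(1 - 2x) = (-1)^n P_n(1 - 2(1 - x)) of Legendre polynomials.  Both of its
    sides are polynomials of degree at most n in x killed by the second-order
    q-difference operator
    [L f = (1 - x) f(x) - (2 - (Q^(-n) + Q^(n+1)) x) f(Q x)
           + (1 - Q x) f(Q^2 x)].
    On monomials, [L f = 0] is the two-term recursion of the a_k; on the basis
    (x; Q)_k, the images of the summands telescope.  The same two-term
    recursion, run downwards from degree n, shows that a polynomial of degree
    at most n in the kernel of L is determined by its coefficient of x^n, and
    these top coefficients agree.

    Finally the factor (-1)^n is the Legendre symbol of -1 (Euler's criterion,
    lemma [legendreN1]), and q^((1 - p^2)/4) = Q^(-n(n+1)/2). *)

(** * The q-shifted factorials (x; b)_k as polynomials in x *)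

Lemma qpochS (R : comNzRingType) (a b : R) n :
  qpoch a b n.+1 = qpoch a b n * (1 - a * b ^+ n).
Proof. by rewrite /qpoch big_ord_recr. Qed.

Lemma qpoch_shift (R : comNzRingType) (a b : R) n :
  qpoch a b n.+1 = (1 - a) * qpoch (a * b) b n.
Proof.
rewrite /qpoch big_ord_recl expr0 mulr1; congr (_ * _).
by apply: eq_bigr => i _; rewrite /= /bump /= add1n exprS mulrA.
Qed.

Lemma coef_comp_scaleX (R : comNzRingType) (a : R) (f : {poly R}) k :
  (f \Po (a *: 'X))`_k = a ^+ k * f`_k.
Proof.
rewrite comp_polyE.
under eq_bigr => i _ do rewrite exprZn scalerA.
rewrite -(poly_def _ (fun i => f`_i * a ^+ i)) coef_poly.
case: ltnP => hk; first exact: mulrC.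
by rewrite nth_default ?mulr0.
Qed.

Lemma qpochX_comp_scaleX (R : comNzRingType) (a b : R) k :
  qpoch 'X b%:P k \Po (a *: 'X) = qpoch (a *: 'X) b%:P k.
Proof.
rewrite /qpoch rmorph_prod /=; apply: eq_bigr => i _.
by rewrite rmorphB rmorph1 rmorphM rmorphXn /= comp_polyC comp_polyX.
Qed.

Lemma coef_qpochX0 (R : comNzRingType) (b : R) k j :
  (k < j)%N -> (qpoch 'X b%:P k)`_j = 0.
Proof.
elim: k j => [|k IH] j hj; first by rewrite /qpoch big_ord0 coef1 gtn_eqF.
rewrite qpochS mulrBr mulr1 mulrA -rmorphXn coefB coefMC coefMX.
by case: j hj => // j hj; rewrite !IH ?mul0r ?subr0 //= ltnW.
Qed.

Lemma coef_qpochX_top (R : comNzRingType) (b : R) k :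
  (qpoch 'X b%:P k)`_k = (-1) ^+ k * b ^+ 'C(k, 2).
Proof.
elim: k => [|k IH]; first by rewrite /qpoch big_ord0 coef1 expr0 mulr1.
rewrite qpochS mulrBr mulr1 mulrA -rmorphXn coefB coefMC coefMX /= IH.
by rewrite coef_qpochX0 // binS bin1 exprD exprS; ring.
Qed.

(** * The q-difference operator and the reflection identity *)

(** The coefficients of 2phi1(Q^-n, Q^(n+1); Q; Q, x), a q-analogue of the
    Legendre polynomial P_n(1 - 2x). *)
Definition qleg_coef (F : fieldType) (Q : F) n k : F :=
  qpoch (Q ^- n) Q k * qpoch (Q ^+ n.+1) Q k / qpoch Q Q k ^+ 2.

(** With eta f(x) = f(Qx), this is
    (1 - eta)^2 - x (1 - Q^-n eta) (1 - Q^(n+1) eta) expanded in powers of eta: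
    the q-hypergeometric operator of 2phi1(Q^-n, Q^(n+1); Q; Q, x). *)
Definition qleg_op (F : fieldType) (Q : F) n (f : {poly F}) : {poly F} :=
  (1 - 'X) * f - (2%:R - (Q ^- n + Q ^+ n.+1)%:P * 'X) * (f \Po (Q *: 'X))
  + (1 - Q%:P * 'X) * (f \Po ((Q ^+ 2) *: 'X)).

Section QLeg.
Context (F : fieldType) (Q : F) (n : nat).
Hypothesis Q0 : Q != 0.
Hypothesis Q_not_root1 : forall k, Q ^+ k.+1 != 1.
Local Notation a := (qleg_coef Q n).
Local Notation L := (qleg_op Q n).

Lemma qpochQ_neq0 k : qpoch Q Q k != 0.
Proof.
by apply/prodf_neq0 => i _; rewrite -exprS subr_eq0 eq_sym Q_not_root1.
Qed.

Lemma qleg_coefS k :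
  a k.+1 * (1 - Q ^+ k.+1) ^+ 2 =
  a k * (1 - Q ^- n * Q ^+ k) * (1 - Q ^+ n.+1 * Q ^+ k).
Proof.
rewrite /qleg_coef !qpochS -exprS.
have := qpochQ_neq0 k; have : 1 - Q ^+ k.+1 != 0 by rewrite subr_eq0 eq_sym.
move: (1 - Q ^+ k.+1) (qpoch Q Q k) => u v u0 v0.
have e : u ^+ 2 / (v * u) ^+ 2 = (v ^+ 2)^-1.
  by rewrite exprMn invfM mulrCA divff ?mulr1 // expf_neq0.
rewrite -[LHS]mulrA [_ * u ^+ 2]mulrC e; ring.
Qed.

(** The numerator contains the factor 1 - Q^-n Q^n. *)
Lemma qleg_coef0 k : (n < k)%N -> a k = 0.
Proof.
move=> nk; rewrite /qleg_coef /qpoch (bigD1 (Ordinal nk)) //=.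
by rewrite mulVf ?expf_neq0 // subrr !mul0r.
Qed.

Lemma coef_qleg_sum N k :
  (n < N)%N -> (\sum_(i < N) a i *: 'X^i)`_k = a k.
Proof.
move=> nN; rewrite -poly_def coef_poly; case: ltnP => // hk.
by rewrite qleg_coef0 ?(leq_trans nN).
Qed.

Lemma qleg_quad (K : F) :
  (1 - Q ^- n * K) * (1 - Q ^+ n.+1 * K)
  = 1 - (Q ^- n + Q ^+ n.+1) * K + Q * K ^+ 2.
Proof.
have e : Q ^- n * Q ^+ n.+1 = Q by rewrite exprSr mulrA mulVf ?mul1r ?expf_neq0.
rewrite -[in Q * _]e; ring.
Qed.

Lemma coef_qleg_op f k :
  (L f)`_k.+1 = (1 - Q ^+ k.+1) ^+ 2 * f`_k.+1
    - (1 - Q ^- n * Q ^+ k) * (1 - Q ^+ n.+1 * Q ^+ k) * f`_k.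
Proof.
rewrite qleg_quad /qleg_op !mulrBl !mul1r.
rewrite !(coefB, coefD) -polyC_natr -!mulrA !coefCM !coefXM /=.
rewrite !coef_comp_scaleX ![Q ^+ 2 ^+ _]exprAC [Q ^+ k.+1]exprS.
by move: (Q ^- n + _) (Q ^+ k) => c K; ring.
Qed.

(** In [coef_qleg_op] the factor of the lower coefficient f_k vanishes only for
    Q^k = Q^n or Q^(n+1+k) = 1, so for k < n it can be solved for f_k. *)
Lemma qleg_op_inj (f : {poly F}) :
  L f = 0 -> f`_n = 0 -> forall k, (k <= n)%N -> f`_k = 0.
Proof.
move=> Lf fn k kn; rewrite -(subKn kn).
elim: (n - k)%N (leq_subr k n) => [|j IH] hj; first by rewrite subn0.
have := coef_qleg_op f (n - j.+1).
rewrite Lf coef0 subnSK // IH ?(ltnW hj) // mulr0 sub0r.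
move/esym/eqP; rewrite oppr_eq0 !mulf_eq0 => /orP[/orP[]|/eqP //].
- rewrite subr_eq0 => /eqP e; case/eqP: (Q_not_root1 j).
  by rewrite -[LHS]mulr1 e mulrCA -exprD subnKC // mulVf ?expf_neq0.
- by rewrite -exprD addSn subr_eq0 eq_sym (negPf (Q_not_root1 _)).
Qed.

Local Notation b' k := (qpoch (Q *: 'X) Q%:P k).

(** Up to the factor x, the image of (x; Q)_k combines only the two consecutive
    shifted factorials (Qx; Q)_(k-1) and (Qx; Q)_k.  Their coefficients are the
    two factors of the recursion [qleg_coefS], which makes
    [qleg_op_qpoch_sum] telescope. For k = 0 the first coefficient is 0, so
    that k.-1 = 0 is harmless there. *)
Lemma qleg_op_qpoch k :
  Q ^+ k *: L (qpoch 'X Q%:P k) =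
  'X * ((1 - Q ^+ k) ^+ 2 *: b' k.-1
        - ((1 - Q ^- n * Q ^+ k) * (1 - Q ^+ n.+1 * Q ^+ k)) *: b' k).
Proof.
rewrite /qleg_op !qpochX_comp_scaleX qleg_quad; move: (Q ^- n + _) => c.
case: k => [|k].
  rewrite /qpoch !big_ord0 !expr0 !scale1r -!mul_polyC.
  by rewrite !(rmorphB, rmorphD, rmorphM, rmorphXn, rmorph1) /=; ring.
have -> : (1 - Q%:P * 'X) * qpoch (Q ^+ 2 *: 'X) Q%:P k.+1 = b' k.+2.
  rewrite [RHS]qpoch_shift mul_polyC; congr (_ * qpoch _ _ _).
  by rewrite mulrC mul_polyC scalerA.
rewrite qpoch_shift !qpochS.
rewrite [X in qpoch X _ k]mulrC [X in qpoch X _ k]mul_polyC /=.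
set E := qpoch _ _ k; rewrite -!mul_polyC.
rewrite !(rmorphB, rmorphD, rmorphM, rmorphXn, rmorph1) /=.
rewrite [_%:P ^+ k.+1]exprS.
by move: (c%:P) (Q%:P) (_ ^+ k) => d q K; ring.
Qed.

Lemma qleg_opD f g : L (f + g) = L f + L g.
Proof. by rewrite /qleg_op !rmorphD /=; ring. Qed.

Lemma qleg_opZ (c : F) f : L (c *: f) = c *: L f.
Proof. by rewrite /qleg_op !comp_polyZ -!mul_polyC; ring. Qed.

Lemma qleg_op_sum N (G : nat -> {poly F}) :
  L (\sum_(k < N) G k) = \sum_(k < N) L (G k).
Proof.
elim: N => [|N IH]; last by rewrite !big_ord_recr /= qleg_opD IH.
by rewrite !big_ord0 /qleg_op !comp_poly0 !mulr0 subrr addr0.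
Qed.

Lemma qleg_op_monomials N : (n < N)%N -> L (\sum_(k < N) a k *: 'X^k) = 0.
Proof.
move=> nN; apply/polyP => -[|k]; last first.
  by rewrite coef_qleg_op !coef_qleg_sum // mulrC qleg_coefS coef0; ring.
rewrite coef0 /qleg_op !mulrBl !mul1r.
rewrite !(coefB, coefD) -polyC_natr -!mulrA !coefCM !coefXM /=.
by rewrite !coef_comp_scaleX; ring.
Qed.

Lemma qleg_op_qpoch_sum N :
  (n < N)%N -> L (\sum_(k < N) (a k * Q ^+ k) *: qpoch 'X Q%:P k) = 0.
Proof.
move=> nN; pose T k := ((1 - Q ^+ k) ^+ 2 * a k) *: b' k.-1.
rewrite (qleg_op_sum _ (fun k => (a k * Q ^+ k) *: qpoch 'X Q%:P k)).
transitivity (- ('X * \sum_(0 <= k < N) (T k.+1 - T k))).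
  rewrite big_mkord mulr_sumr -sumrN; apply: eq_bigr => k _.
  rewrite qleg_opZ -scalerA qleg_op_qpoch scalerAr -[RHS]mulrN opprB.
  congr (_ * _).
  rewrite scalerBr !scalerA [in RHS]/T /= ![(1 - _) ^+ 2 * _]mulrC qleg_coefS.
  by rewrite -(mulrA (a k) (1 - Q ^- n * _)).
(* The end terms vanish: T N because a N = 0, and T 0 because 1 - Q^0 = 0. *)
rewrite (telescope_sumr T) // /T qleg_coef0 // expr0 subrr expr0n.
by rewrite mulr0 mul0r !scale0r subrr mulr0 oppr0.
Qed.

(** The difference of the two sides lies in the kernel of L and has degree at
    most n, so by [qleg_op_inj] only the coefficients of x^n are left to
    compare; on the right that coefficient comes from (x; Q)_n alone. *)
Lemma qleg_reflection N : (n < N)%N ->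
  \sum_(k < N) a k *: 'X^k =
  ((-1) ^+ n * Q ^- 'C(n.+1, 2)) *:
    \sum_(k < N) (a k * Q ^+ k) *: qpoch 'X Q%:P k.
Proof.
move=> nN; set f := LHS; set s := _ * _; set g := \sum_(_ < _) (_ * _) *: _.
have fE k : f`_k = a k by exact: coef_qleg_sum.
have g_big k : (n < k)%N -> g`_k = 0.
  move=> nk; rewrite coef_sum big1 // => i _; rewrite coefZ.
  case: (ltnP n i) => ni; first by rewrite qleg_coef0 // !mul0r.
  by rewrite coef_qpochX0 ?mulr0 // (leq_ltn_trans ni).
have g_top : g`_n = a n * Q ^+ n * ((-1) ^+ n * Q ^+ 'C(n, 2)).
  rewrite coef_sum (bigD1 (Ordinal nN)) //= coefZ coef_qpochX_top.
  rewrite big1 ?addr0 // => i ik.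
  rewrite coefZ; have: (i : nat) != n by [].
  rewrite neq_ltn => /orP[] ni; last by rewrite qleg_coef0 // !mul0r.
  by rewrite coef_qpochX0 ?mulr0.
have Lh : L (f + -1 *: (s *: g)) = 0.
  rewrite qleg_opD !qleg_opZ qleg_op_monomials ?qleg_op_qpoch_sum //.
  by rewrite !scaler0 addr0.
have hn : (f + -1 *: (s *: g))`_n = 0.
  (* The powers of Q cancel because C(n+1, 2) = C(n, 2) + n. *)
  rewrite coefD !coefZ fE g_top /s binS bin1 exprD.
  set B := Q ^+ 'C(n, 2) * Q ^+ n.
  have B0 : B != 0 by rewrite mulf_neq0 // expf_neq0.
  transitivity (a n - a n * ((-1) ^+ n) ^+ 2 * (B^-1 * B)).
    by rewrite /B; ring.
  by rewrite sqrr_sign mulVf // !mulr1 subrr.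
apply/polyP => k; case: (leqP k n) => [kn|nk].
  have := qleg_op_inj Lh hn kn; rewrite coefD [in X in _ + X]coefZ mulN1r.
  by move/eqP; rewrite subr_eq0 => /eqP.
by rewrite coefZ g_big // mulr0 fE qleg_coef0.
Qed.

End QLeg.

(** * Multiples of M^r in the localization of Q[q] at M *)

(** For r = 0 this is membership in the localization itself.  Having that ring
    and its ideals in one family lets the same closure lemmas serve for the
    integrality conditions and for the congruence in [qcong]. *)
Definition loc_ideal (M : {poly rat}) (r : nat) (A : Qq) : Prop :=
  exists N D : {poly rat},
    [/\ M ^+ r %| N, coprimep D M & A = tofrac N / tofrac D].

Section LocIdeal.
Context (M : {poly rat}).
Hypothesis sM : size M != 1%N.

Lemma coprimep_neq0 D : coprimep D M -> tofrac D != 0 :> Qq.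
Proof.
rewrite tofrac_eq0; apply: contraTneq => ->.
by rewrite coprime0p -size_poly_eq1.
Qed.

Lemma loc_idealD r A B :
  loc_ideal M r A -> loc_ideal M r B -> loc_ideal M r (A + B).
Proof.
move=> [N1 [D1 [d1 c1 ->]]] [N2 [D2 [d2 c2 ->]]].
exists (N1 * D2 + N2 * D1), (D1 * D2); split.
- by rewrite dvdp_add // dvdp_mulr.
- by rewrite coprimepMl c1.
- by rewrite tofracD !tofracM addf_div // coprimep_neq0.
Qed.

Lemma loc_idealM r A B :
  loc_ideal M 0 A -> loc_ideal M r B -> loc_ideal M r (A * B).
Proof.
move=> [N1 [D1 [_ c1 ->]]] [N2 [D2 [d2 c2 ->]]].
exists (N1 * N2), (D1 * D2); split.
- by rewrite dvdp_mull.
- by rewrite coprimepMl c1.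
- by rewrite !tofracM mulf_div.
Qed.

Lemma loc_ideal_poly r P : M ^+ r %| P -> loc_ideal M r (tofrac P).
Proof. by exists P, 1; split; rewrite ?coprime1p // tofrac1 divr1. Qed.

Lemma loc_polyV D : coprimep D M -> loc_ideal M 0 (tofrac D)^-1.
Proof. by exists 1, D; split; rewrite ?expr0 // tofrac1 mul1r. Qed.

Lemma loc_ideal0 r : loc_ideal M r 0.
Proof. by rewrite -tofrac0; apply: loc_ideal_poly; rewrite dvdp0. Qed.

Lemma loc1 : loc_ideal M 0 1.
Proof. by rewrite -tofrac1; apply: loc_ideal_poly; rewrite expr0. Qed.

Lemma locN1 : loc_ideal M 0 (-1).
Proof.
by rewrite -tofrac1 -tofracN; apply: loc_ideal_poly; rewrite expr0 dvd1p.
Qed.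

Lemma loc_idealB r A B :
  loc_ideal M r A -> loc_ideal M r B -> loc_ideal M r (A - B).
Proof.
move=> hA hB; apply: loc_idealD => //; rewrite -mulN1r.
exact: loc_idealM locN1 hB.
Qed.

Lemma loc_exp n A : loc_ideal M 0 A -> loc_ideal M 0 (A ^+ n).
Proof.
move=> hA; elim: n => [|n IH]; first exact: loc1.
by rewrite exprS; apply: loc_idealM.
Qed.

Lemma loc_ideal_sum r n (G : 'I_n -> Qq) :
  (forall i, loc_ideal M r (G i)) -> loc_ideal M r (\sum_(i < n) G i).
Proof.
move=> hG; apply: (big_ind (loc_ideal M r)) => //.
  exact: loc_ideal0.
exact: loc_idealD.
Qed.

Lemma loc_qpoch a b n :
  loc_ideal M 0 a -> loc_ideal M 0 b -> loc_ideal M 0 (qpoch a b n).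
Proof.
move=> ha hb; apply: (big_ind (loc_ideal M 0)) => [||i _].
- exact: loc1.
- exact: loc_idealM.
by apply: loc_idealB; [exact: loc1 | apply: loc_idealM => //; exact: loc_exp].
Qed.

Lemma loc_coef_qpochX b k j :
  loc_ideal M 0 b -> loc_ideal M 0 (qpoch 'X b%:P k)`_j.
Proof.
move=> hb; elim: k j => [|k IH] j.
  rewrite /qpoch big_ord0 coef1.
  by case: (j == 0%N); [exact: loc1 | exact: loc_ideal0].
rewrite qpochS mulrBr mulr1 mulrA -rmorphXn coefB coefMC coefMX mulrC.
apply: loc_idealB => //; apply: loc_idealM; first exact: loc_exp.
by case: j => [|j] //=; exact: loc_ideal0.
Qed.

Lemma qcong_loc r A B : loc_ideal M 0 A -> loc_ideal M 0 B ->
  loc_ideal M r (A - B) -> qcong M r A B.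
Proof.
move=> [N1 [D1 [_ c1 e1]]] [N2 [D2 [_ c2 e2]]] hAB.
by split=> //; [exists N1, D1 | exists N2, D2].
Qed.
End LocIdeal.

(** * Coprimality to [p] *)

Lemma qint_mul n : (1 - 'X^n : {poly rat}) = (1 - 'X) * qint n.
Proof. by rewrite -opprB subrX1 -mulNr opprB. Qed.

(** With u m = v p + 1, a common divisor divides both 1 - q^(um) and
    1 - q^(vp), hence q - 1, whereas the value of [p] at q = 1 is p. *)
Lemma coprimep_1subXn_qint p m :
  prime p -> ~~ (p %| m)%N -> coprimep (1 - 'X^m) (qint p).
Proof.
move=> pp pm; rewrite coprimep_sym; apply/coprimepP => d dM dm.
have m0 : (0 < m)%N by case: m pm {dm} => //; rewrite dvdn0.
have mul u v : d %| 1 - 'X^u -> d %| 1 - 'X^(v * u).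
  move=> h; rewrite mulnC exprM -{1}(expr1n _ v) subrXX; exact: dvdp_mulr.
have dp : d %| 1 - 'X^p by rewrite qint_mul dvdp_mull.
have d1 : d %| 'X - 1%:P.
  case: (egcdnP p m0) => u v e _.
  have {e} e: (u * m = v * p + 1)%N.
    rewrite e; congr (_ + _)%N; apply/eqP.
    by rewrite -/(coprime _ _) coprime_sym prime_coprime.
  have -> : 'X - 1%:P = (1 - 'X^(v * p)) * 'X - (1 - 'X^(u * m)) :> {poly rat}.
    by rewrite e exprD expr1; ring.
  by rewrite dvdp_sub ?dvdp_mulr ?mul.
have c : coprimep (qint p) ('X - 1%:P).
  rewrite coprimep_XsubC rootE /qint horner_sum.
  under eq_bigr => i _ do rewrite hornerXn expr1n.
  by rewrite sumr_const card_ord pnatr_eq0 -lt0n prime_gt0.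
exact: (coprimepP _ _ c d dM d1).
Qed.

Lemma size_qint n : size (qint n) = n.
Proof.
rewrite /qint; under eq_bigr => i _ do rewrite -(scale1r 'X^i).
case: n => [|n]; first by rewrite big_ord0 size_poly0.
by rewrite -(poly_def n.+1 (fun=> 1)) size_poly_eq ?oner_neq0.
Qed.

Lemma coprimep_Xn_qint p n : (0 < p)%N -> coprimep 'X^n (qint p).
Proof.
move=> p0; apply: coprimep_expl; rewrite coprimep_sym -['X]subr0 coprimep_XsubC.
case: p p0 => // p _; rewrite rootE horner_sum big_ord_recl hornerXn.
rewrite big1 ?addr0 ?oner_neq0 // => i _; by rewrite hornerXn expr0n.
Qed.

(** * The Legendre symbol of -1 *)

(** Let n = (p - 1) / 2.  If y^2 = -1, then 1 = y^(p-1) = (-1)^n by Fermat, so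
    n is even.  Conversely x^n = 1 has at most n
    solutions, so some nonzero y has y^n != 1, hence y^n = -1; if n is even,
    y^(n/2) is then a square root of -1. *)
Lemma legendreN1 p : prime p -> odd p -> legendre (-1) p = (-1) ^+ p./2.
Proof.
move=> pp po; rewrite /legendre dvdzE abszN /= dvdn1 gtn_eqF ?prime_gt1 //.
set n := p./2; have pE : p = (n * 2).+1.
  by rewrite muln2 -{1}(odd_double_half p) po.
have n0 : (0 < n)%N by case: n pE (prime_gt1 pp) => // ->.
have fermat (y : 'F_p) : y != 0 -> (y ^+ n) ^+ 2 = 1.
  move=> y0; apply: (mulfI y0); rewrite -exprM -exprS -pE mulr1.
  by rewrite -{2}(expf_card y) card_Fp.
have N1 : (-1 : 'F_p) != 1.
  rewrite eq_sym -subr_eq0 opprK -(natrD _ 1 1).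
  rewrite -(dvdn_pcharf (pchar_Fp pp)) dvdn_prime2 //.
  by apply: contraTneq po => ->.
rewrite rmorphN1 /=; case: (boolP (odd n)) => no; rewrite -signr_odd.
- rewrite no expr1 ifF //; apply/existsP => -[y /eqP hy].
  have y0 : y != 0.
    by apply: contra_eq_neq hy => ->; rewrite expr0n eq_sym oppr_eq0 oner_neq0.
  move: (fermat y y0); rewrite exprAC hy -signr_odd no expr1 => /eqP.
  by rewrite (negPf N1).
- rewrite (negPf no) expr0 ifT //.
  have /existsP[y /andP[y0 yn]] :
      [exists y : 'F_p, (y != 0) && (y ^+ n != 1)].
    apply: contraT; rewrite negb_exists => /forallP h.
    have := @max_unity_roots _ n (enum [pred y : 'F_p | y != 0]) n0.
    rewrite enum_uniq -cardE => /(_ _ isT).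
    have -> : #|[pred y : 'F_p | y != 0]| = (n * 2)%N.
      by have := cardC1 (0 : 'F_p); rewrite card_Fp // pE.
    rewrite leqNgt ltn_Pmulr // => H; apply: H; apply/allP => y.
    rewrite mem_enum inE => y0; apply/unity_rootP; apply/eqP.
    by move: (h y); rewrite y0 negbK.
  apply/existsP; exists (y ^+ n./2); rewrite -exprM muln2 even_halfK //.
  by move/eqP: (fermat y y0); rewrite sqrf_eq1 (negPf yn).
Qed.

(** * The congruence modulo [p]^2 *)

Lemma qvar_not_root1 k : (qvar ^+ 2) ^+ k.+1 != 1.
Proof.
rewrite -exprM /qvar -tofracXn -tofrac1 tofrac_eq -subr_eq0 -size_poly_eq0.
by rewrite size_XnsubC.
Qed.

(** With x = q, N = q^(2n) and K = q^(2j), the last factor is (1 - q^p)^2: this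
    is where the modulus [p]^2 comes from. *)
Lemma sqr_sub_shift (F : fieldType) (x K N : F) : N != 0 ->
  (1 - x * K) ^+ 2 - (1 - N^-1 * K) * (1 - x ^+ 2 * N * K)
  = N^-1 * K * (1 - x * N) ^+ 2.
Proof. by move=> N0; field. Qed.

Section Supercongruence.
Context (p n : nat).
Hypothesis p_prime : prime p.
Hypothesis pE : p = (n * 2).+1.
Local Notation M := (qint p).
Local Notation q := qvar.
Local Notation Q := (qvar ^+ 2).

Lemma size_qint_neq1 : size M != 1%N.
Proof. by rewrite size_qint gtn_eqF ?prime_gt1. Qed.
Local Notation sM := size_qint_neq1.

Lemma loc_qvar : loc_ideal M 0 q.
Proof. by apply: loc_ideal_poly; rewrite expr0 dvd1p. Qed.

Lemma loc_qvarX k : loc_ideal M 0 (q ^+ k).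
Proof. exact: loc_exp loc_qvar. Qed.

Lemma loc_qvarXV k : loc_ideal M 0 (q ^- k).
Proof.
rewrite -tofracXn; apply: loc_polyV; apply: coprimep_Xn_qint.
exact: prime_gt0.
Qed.

Lemma loc_qpochV k : (k < p)%N -> loc_ideal M 0 (qpoch Q Q k)^-1.
Proof.
elim: k => [|k IH] hk; first by rewrite /qpoch big_ord0 invr1; exact: loc1.
rewrite qpochS invfM; apply: loc_idealM => //; first by apply: IH; rewrite ltnW.
rewrite -exprS -exprM -tofracXn -tofrac1 -tofracB; apply: loc_polyV.
apply: coprimep_1subXn_qint => //; rewrite Euclid_dvdM // negb_or.
have p_gt2 : (2 < p)%N.
  have : (0 < n)%N.
    by rewrite lt0n; apply: contraTneq p_prime => n0; rewrite pE n0.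
  by rewrite pE; case: (n).
by rewrite !gtnNdvd.
Qed.

Lemma qpoch_sqr_cong k :
  loc_ideal M 2
    (qpoch q Q k ^+ 2 - qpoch (Q ^- n) Q k * qpoch (Q ^+ n.+1) Q k).
Proof.
have lQ : loc_ideal M 0 Q by exact: loc_qvarX.
have lQn : loc_ideal M 0 (Q ^- n) by rewrite -exprM; exact: loc_qvarXV.
have lQn1 : loc_ideal M 0 (Q ^+ n.+1) by exact: loc_exp.
elim: k => [|k IH].
  rewrite /qpoch !big_ord0 expr1n mulr1 subrr; exact: loc_ideal0.
rewrite !qpochS.
set A := qpoch q Q k; set B := qpoch _ Q k; set C := qpoch _ Q k.
set u := 1 - q * Q ^+ k; set v := 1 - Q ^- n * _; set w := 1 - Q ^+ n.+1 * _.
have step : loc_ideal M 2 (u ^+ 2 - v * w).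
  have -> : u ^+ 2 - v * w = Q ^- n * Q ^+ k * tofrac ((1 - 'X^p) ^+ 2).
    rewrite tofracXn tofracB tofracXn tofrac1 -/qvar.
    have -> : q ^+ p = q * Q ^+ n by rewrite pE exprS mulnC exprM.
    rewrite -sqr_sub_shift /u /v /w ?[Q ^+ n.+1]exprS //.
    by rewrite -exprM expf_neq0 // tofrac_eq0 polyX_eq0.
  apply: loc_idealM; first by apply: loc_idealM; [exact: lQn | exact: loc_exp].
  by apply: loc_ideal_poly; rewrite dvdp_exp2r // qint_mul dvdp_mull.
have -> : (A * u) ^+ 2 - B * v * (C * w)
    = u ^+ 2 * (A ^+ 2 - B * C) + B * C * (u ^+ 2 - v * w) by ring.
apply: (loc_idealD sM); apply: loc_idealM => //.
- apply/loc_exp/(loc_idealB sM); first exact: loc1.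
  by apply: loc_idealM; [exact: loc_qvar | exact: loc_exp].
- by apply: loc_idealM; apply: loc_qpoch => //; exact: sM.
Qed.

Local Notation c k := (qpoch q Q k ^+ 2 / qpoch Q Q k ^+ 2).

Lemma coef_cong k : (k < p)%N -> loc_ideal M 2 (c k - qleg_coef Q n k).
Proof.
move=> kp; rewrite /qleg_coef -mulrBl mulrC -exprVn; apply: loc_idealM.
  by apply: loc_exp; exact: loc_qpochV.
exact: qpoch_sqr_cong.
Qed.

Lemma loc_c k : (k < p)%N -> loc_ideal M 0 (c k).
Proof.
move=> kp; rewrite -exprVn -exprMn; apply: loc_exp.
apply: loc_idealM; [|exact: loc_qpochV].
by apply: loc_qpoch; [exact: sM|exact: loc_qvar|exact: loc_qvarX].
Qed.

(** Both sides depend linearly on the coefficients u_k, with multipliers in the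
    localization ([loc_monomials], [loc_qpochs] below); for u_k = a_k they are
    equal, so their difference is the one obtained for u_k = c_k - a_k, all of
    which are multiples of [p]^2. *)
Lemma supercongruence s : s = (-1) ^+ n * Q ^- 'C(n.+1, 2) ->
  qcong_poly M 2 (\sum_(k < p) c k *: 'X^k)
    (s *: \sum_(k < p) (c k * Q ^+ k) *: qpoch 'X Q%:P k).
Proof.
move=> sE j.
have ls : loc_ideal M 0 s.
  rewrite sE -exprM; apply: loc_idealM; [|exact: loc_qvarXV].
  by apply: loc_exp; exact: locN1.
have Q0 : Q != 0 by rewrite expf_neq0 // tofrac_eq0 polyX_eq0.
have np : (n < p)%N by rewrite pE ltnS leq_pmulr.
have lb k : loc_ideal M 0 (Q ^+ k * (qpoch 'X Q%:P k)`_j).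
  apply: loc_idealM; [by rewrite -exprM; exact: loc_qvarX|].
  by apply: loc_coef_qpochX; [exact: sM|exact: loc_qvarX].
have coef_qpochs (u : nat -> Qq) :
    (s *: \sum_(k < p) (u k * Q ^+ k) *: qpoch 'X Q%:P k)`_j
    = s * \sum_(k < p) u k * (Q ^+ k * (qpoch 'X Q%:P k)`_j).
  rewrite coefZ coef_sum; congr (_ * _).
  by apply: eq_bigr => i _; rewrite coefZ mulrA.
have coef_monomials (u : nat -> Qq) :
    (\sum_(k < p) u k *: 'X^k)`_j = if (j < p)%N then u j else 0.
  by rewrite -poly_def coef_poly.
have loc_qpochs r (u : nat -> Qq) :
    (forall k, (k < p)%N -> loc_ideal M r (u k)) ->
    loc_ideal M r (s * \sum_(k < p) u k * (Q ^+ k * (qpoch 'X Q%:P k)`_j)).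
  move=> hu; apply: loc_idealM; [exact: ls|].
  apply: loc_ideal_sum; first exact: sM.
  by move=> k; rewrite mulrC; apply: loc_idealM; [exact: lb|exact: hu].
have loc_monomials r (u : nat -> Qq) :
    (forall k, (k < p)%N -> loc_ideal M r (u k)) ->
    loc_ideal M r (if (j < p)%N then u j else 0).
  by move=> hu; case: ifP => [/hu //|_]; exact: loc_ideal0.
have E : \sum_(k < p) qleg_coef Q n k *: 'X^k
   = s *: \sum_(k < p) (qleg_coef Q n k * Q ^+ k) *: qpoch 'X Q%:P k.
  by rewrite sE; exact: (qleg_reflection Q0 qvar_not_root1 np).
move/(congr1 (fun f : {poly Qq} => f`_j)): E.
rewrite (coef_monomials (fun k => c k)) (coef_qpochs (fun k => c k)).
rewrite coef_monomials coef_qpochs => E.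
apply: qcong_loc.
- by apply: (loc_monomials 0 (fun k => c k)); exact: loc_c.
- by apply: (loc_qpochs 0 (fun k => c k)); exact: loc_c.
have := loc_idealB sM (loc_monomials 2 _ coef_cong)
  (loc_qpochs 2 _ coef_cong).
congr (loc_ideal _ _ _).
under [X in _ - _ * X]eq_bigr => k _ do rewrite mulrBl.
rewrite sumrB mulrBr; move: E; case: ifP => _ E; first by rewrite E; ring.
by rewrite -E; ring.
Qed.
End Supercongruence.

Theorem theorem2p3 (p : nat) (p_prime : prime p) (p_odd : odd p) :
  qcong_poly (qint p) 2
    (\sum_(k < p)
       (qpoch qvar (qvar ^+ 2) k ^+ 2
          / qpoch (qvar ^+ 2) (qvar ^+ 2) k ^+ 2) *: 'X^k)
    (((legendre (-1) p)%:~R * qvar ^ ((1 - p%:Z ^+ 2) %/ 4)%Z) *: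
       \sum_(k < p)
         (qpoch qvar (qvar ^+ 2) k ^+ 2
            / qpoch (qvar ^+ 2) (qvar ^+ 2) k ^+ 2 * qvar ^+ (2 * k)) *:
         qpoch 'X (qvar ^+ 2)%:P k).
Proof.
have pE : p = (p./2 * 2).+1 by rewrite muln2 -{1}(odd_double_half p) p_odd.
under [X in _ *: X]eq_bigr => k _ do rewrite exprM.
apply: (supercongruence p_prime pE).
rewrite legendreN1 // intr_sign; congr (_ * _).
have -> : ((1 - p%:Z ^+ 2) %/ 4)%Z = - (2 * 'C(p./2.+1, 2))%N%:Z.
  have e : (2 * 'C(p./2.+1, 2) = p./2.+1 * p./2)%N.
    rewrite mulnC muln2 bin2 /= -[RHS]odd_double_half oddM /=.
    by case: odd.
  have -> : 1 - p%:Z ^+ 2 = - (2 * 'C(p./2.+1, 2))%N%:Z * 4.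
    by rewrite e {1}pE -addn1 !PoszD !PoszM -addn1 PoszD; ring.
  by rewrite mulzK.
by rewrite -exprnN -exprM.
Qed.
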